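(* Let $(G,R)$ be a finite rooted graph without sinks. Then the unfolding tree $\mathcal{T}(G,R)$ is cocompact if and only if $(G,R)$ admits an actual labelling.
   Context: A graph $G=(VG,EG,o,t)$ is a directed multigraph (loops and multiple edges allowed) with origin and terminus maps $o,t:EG\to VG$. A sink is a vertex $v$ with $o^{-1}(v)=\emptyset$. A path is either an empty path $\varepsilon_v$ at a vertex $v$ or a finite sequence $e_1\cdots e_n$ of edges with $t(e_i)=o(e_{i+1})$; $O(p),T(p)$ denote its origin and terminus ($O(\varepsilon_v)=T(\varepsilon_v)=v$). A rooted graph $(G,R)$ is a graph together with a vertex $R$ from which every vertex is reachable by a directed path. A rooted tree is a graph with a vertex $R$ such that for every vertex $v$ there is a unique path from $R$ to $v$. The unfolding tree $\mathcal{T}(G,R)$ has as vertices the paths $p$ with $O(p)=R$, and for each such $p$ and each edge $e$ with $o(e)=T(p)$ an edge $(p,pe)$ from $p$ to $pe$; its root is $\varepsilon_R$. For a rooted tree $\mathcal{T}$ with root $R$ and a vertex $v$, $\mathcal{T}^v$ is the tree with the same vertices and edges but with the direction of every edge on the unique path from $R$ to $v$ reversed (so $\mathcal{T}^v$ is a rooted tree with root $v$). $\cong$ denotes isomorphism of directed graphs. A rooted tree $\mathcal{T}$ is cocompact if there is a finite set $F$ and a map $l:V\mathcal{T}\to F$ such that $l(v)=l(w)$ implies $\mathcal{T}^v\cong\mathcal{T}^w$. Multisets: a multiset over a set $X$ is a finite map assigning positive integer multiplicities to elements of a subset of $X$; union adds multiplicities, and $M\setminus\{x\}$ removes one copy of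 $x$. For a vertex $v$, $t_m(o^{-1}(v))$ is the multiset of termini of the edges leaving $v$ (each vertex counted as many times as there are edges from $v$ to it), and $l(t_m(o^{-1}(v)))$ the corresponding multiset of labels. Actual labelling: for a rooted graph $(G,R)$ with $t^{-1}(R)=\emptyset$, an actual labelling consists of a finite set $X$, maps $l:VG\to X$ and $l_p:VG\setminus\{R\}\to X$, and for each $x\in X$ a multiset $M_x$ over $X$, such that for every $v\in VG\setminus\{R\}$: (1) $l_p(v)\in M_{l(v)}$; (2) $l(t_m(o^{-1}(v)))=M_{l(v)}\setminus\{l_p(v)\}$; (3) for every edge $e$ with $t(e)=v$, $l(o(e))=l_p(v)$; and (4) $l(t_m(o^{-1}(R)))=M_{l(R)}$. (In particular a rooted graph with $t^{-1}(R)\neq\emptyset$ admits no actual labelling.) *)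

(* Defs.v *)
From Stdlib Require List.
From mathcomp Require Import all_boot.
From mathcomp Require Import finmap multiset.
From mathcomp Require Import boolp.

Set Implicit Arguments.
Unset Strict Implicit.
Unset Printing Implicit Defensive.

Record digraph := Digraph {
  vertex : Type;
  edge : Type;
  org : edge -> vertex;
  tgt : edge -> vertex }.

Record finDigraph := FinDigraph {
  fvertex : finType;
  fedge : finType;
  forg : fedge -> fvertex;
  ftgt : fedge -> fvertex }.

Coercion digraph_of_fin (G : finDigraph) : digraph :=
  Digraph (@forg G) (@ftgt G).

Definition is_sink (G : digraph) (v : vertex G) : Prop :=
  forall e : edge G, org e <> v.

Definition sinkless (G : digraph) : Prop := forall v : vertex G, ~ is_sink v.

(* A path is represented by its origin [u] together with its list of edges;
   the empty list with origin [u] is the empty path at [u]. *)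
Fixpoint is_path (G : digraph) (u : vertex G) (p : seq (edge G)) : Prop :=
  if p is e :: q then org e = u /\ is_path (tgt e) q else True.

Definition terminus (G : digraph) (u : vertex G) (p : seq (edge G)) :
  vertex G := last u (map (@tgt G) p).

Definition path_between (G : digraph) (u v : vertex G) (p : seq (edge G)) :
  Prop := is_path u p /\ terminus u p = v.

Definition rooted (G : digraph) (R : vertex G) : Prop :=
  forall v : vertex G, exists p, path_between R v p.

Definition is_rooted_tree (G : digraph) (R : vertex G) : Prop :=
  forall v : vertex G, exists! p, path_between R v p.

Record rootedTree := RootedTree {
  tree_graph :> digraph;
  tree_root : vertex tree_graph;
  tree_axiom : is_rooted_tree tree_root }.

Definition isomorphic (G H : digraph) : Prop :=
  exists (f : vertex G -> vertex H) (g : edge G -> edge H),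
    [/\ bijective f, bijective g,
        forall e, org (g e) = f (org e)
      & forall e, tgt (g e) = f (tgt e)].

(* The edge [e] lies on the (unique) path from the root to [v]. *)
Definition on_root_path (T : rootedTree) (v : vertex T) (e : edge T) : Prop :=
  exists p, path_between (tree_root T) v p /\ List.In e p.

Definition reroot (T : rootedTree) (v : vertex T) : digraph :=
  @Digraph (vertex T) (edge T)
    (fun e => if `[< on_root_path v e >] then tgt e else org e)
    (fun e => if `[< on_root_path v e >] then org e else tgt e).

Definition cocompact (T : rootedTree) : Prop :=
  exists (F : finType) (l : vertex T -> F),
    forall v w : vertex T, l v = l w -> isomorphic (reroot v) (reroot w).

Section Unfolding.
Variables (G : digraph) (R : vertex G).

Definition unf_vertex : Type := {p : seq (edge G) | is_path R p}.

(* The edge from [p] to [pe], for [e] with origin the terminus of [p]. *)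
Record unf_edge : Type := UnfEdge {
  unf_path : unf_vertex;
  unf_last : edge G;
  unf_edgeP : org unf_last = terminus R (sval unf_path) }.

Lemma terminus_rcons (u : vertex G) p e : terminus u (rcons p e) = tgt e.
Proof. by rewrite /terminus map_rcons last_rcons. Qed.

Lemma is_path_rcons (u : vertex G) p e :
  is_path u (rcons p e) <-> is_path u p /\ org e = terminus u p.
Proof.
elim: p u => [|d p IH] u /=; first by split=> [[]|[]].
have := IH (tgt d); rewrite {2}/terminus /= -/(terminus (tgt d) p) => {}IH.
split; first by case=> du /IH [].
by case=> [[du pd] ep]; split=> //; apply/IH.
Qed.

Definition unf_tgt (d : unf_edge) : unf_vertex :=
  exist (is_path R) (rcons (sval (unf_path d)) (unf_last d))
    (iffRL (is_path_rcons _ _ _)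
       (conj (proj2_sig (unf_path d)) (unf_edgeP d))).

Definition unf_root : unf_vertex := exist (is_path R) [::] I.

Definition unf_graph : digraph := Digraph unf_path unf_tgt.

Lemma unf_edge_inj (d d' : unf_edge) :
  unf_path d = unf_path d' -> unf_last d = unf_last d' -> d = d'.
Proof.
case: d d' => [p e pe] [p' e' pe'] /= pp' ee'; subst p' e'.
by congr UnfEdge; apply: Prop_irrelevance.
Qed.

End Unfolding.

Lemma unf_graph_tree (G : digraph) (R : vertex G) :
  is_rooted_tree (unf_root R : vertex (unf_graph R)).
Proof.
case=> p; elim/last_ind: p => [|p e IH] pP.
  exists [::]; split; first by split=> //; apply: eq_exist.
  move=> q [_]; case/lastP: q => // q d; rewrite terminus_rcons.
  by move=> /(congr1 sval) /= /(congr1 size); rewrite size_rcons.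
have [pR pe] := (is_path_rcons R p e).1 pP.
have [q [[qP qT] qU]] := IH pR.
pose d : edge (unf_graph R) := @UnfEdge G R (exist _ p pR) e pe.
exists (rcons q d); split.
  split; first by apply/(@is_path_rcons (unf_graph R)).
  by rewrite terminus_rcons; apply: eq_exist.
move=> q' []; case/lastP: q' => [_|q' d'].
  by move=> /(congr1 sval) /= /(congr1 size); rewrite size_rcons.
move=> /(@is_path_rcons (unf_graph R)) [q'P dT].
rewrite terminus_rcons => /(congr1 sval) /= /rcons_inj [d'p d'e].
have d'pE : unf_path d' = exist _ p pR.
  by case: (unf_path d') d'p => r rP /= ?; apply: eq_exist.
have -> : d' = d by apply: unf_edge_inj.
by rewrite (qU q') //; split=> //; rewrite -dT.
Qed.

Definition unfolding_tree (G : digraph) (R : vertex G) : rootedTree :=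
  @RootedTree (unf_graph R) (unf_root R) (@unf_graph_tree G R).

Local Open Scope mset_scope.

(* [t_m(o^{-1}(v))] *)
Definition out_mset (G : finDigraph) (v : fvertex G) : {mset fvertex G} :=
  seq_mset [seq ftgt e | e <- enum (fedge G) & forg e == v].

Definition mset_map (A B : choiceType) (f : A -> B) (M : {mset A}) : {mset B} :=
  seq_mset [seq f a | a <- enum_mset M].

Record is_actual_labelling (G : finDigraph) (R : fvertex G) (X : finType)
    (l : fvertex G -> X) (lp : {v : fvertex G | v != R} -> X)
    (M : X -> {mset X}) : Prop := IsActualLabelling {
  al_root_in : forall e : fedge G, ftgt e <> R;
  al_parent : forall v, lp v \in M (l (val v));
  al_out : forall v,
    mset_map l (out_mset (val v)) = M (l (val v)) `\ lp v;
  al_in : forall v (e : fedge G), ftgt e = val v -> l (forg e) = lp v;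
  al_out_root : mset_map l (out_mset R) = M (l R) }.

Definition admits_actual_labelling (G : finDigraph) (R : fvertex G) : Prop :=
  exists (X : finType) (l : fvertex G -> X)
         (lp : {v : fvertex G | v != R} -> X) (M : X -> {mset X}),
    is_actual_labelling l lp M.

(* Main.v *)
(* Both directions compare vertices of the tree, i.e. paths of [G] from [R], by
   the multiset of colours of all their neighbours, parent included.

   If the tree is cocompact, colour refinement is constant on isomorphism types
   of rerooted trees, so it stabilises after some number [N] of rounds. The
   [N]-th colour of a path only depends on its last [N] edges and the vertex they
   start from, so two paths with the same terminus have equally coloured
   extensions once these are long enough; going back up, the colour of a parent
   is what remains of the neighbour colours after removing those of the children
   (there is always a child since [G] has no sinks). Hence stable colours descend
   to vertices of [G], and they form an actual labelling.

   Conversely, an actual labelling pulls back to a labelling of the tree for which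
   the multiset of labels of the neighbours of a vertex depends only on its own
   label. Two trees rerooted at equally labelled vertices are then matched level
   by level, identifying the children of matched vertices in the order of their
   labels. *)
From HB Require Import structures.
Require Import Defs.
From Stdlib Require List.
From mathcomp Require Import all_boot.
From mathcomp Require Import finmap multiset.
From mathcomp Require Import boolp.

Set Implicit Arguments.
Unset Strict Implicit.
Unset Printing Implicit Defensive.

(** * Isomorphism of rooted trees from locally matching labels *)

(** [br_height] is merely a measure forcing iterated parents to reach the root; [br_parent] at the
    root is arbitrary. *)
Record branching (V Y : eqType) := Branching {
  br_root : V;
  br_parent : V -> V;
  br_children : V -> seq V;
  br_label : V -> Y;
  br_height : V -> nat;
  br_uniq : forall u, uniq (br_children u);
  br_mem : forall x u,
    (x \in br_children u) = (x != br_root) && (br_parent x == u);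
  br_heightP : forall x, x != br_root ->
    br_height (br_parent x) < br_height x }.

Section Transfer.
Variables V Y : eqType.
Implicit Types A B : branching V Y.

Lemma branching_ind A (P : V -> Prop) :
  P (br_root A) -> (forall x, x != br_root A -> P (br_parent A x) -> P x) ->
  forall x, P x.
Proof.
move=> P0 PS x; have [n] := ubnP (br_height A x).
elim: n x => // n IH x; rewrite ltnS => xn.
have [->//|x0] := eqVneq x (br_root A).
by apply: PS => //; apply: IH; apply: leq_trans xn; apply: br_heightP.
Qed.

(** Label lists, not multisets, are compared, so that matching children by position preserves
    labels. *)
Definition compatible A B :=
  br_label A (br_root A) = br_label B (br_root B) /\
  forall u v, br_label A u = br_label B v ->
    map (br_label A) (br_children A u) = map (br_label B) (br_children B v).

Lemma compatible_sym A B : compatible A B -> compatible B A.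
Proof. by case=> r c; split=> // u v /esym/c. Qed.

(** The vertex [u] is sent to the child of its parent's image at the index [u] has among its
    siblings. The fuel [n] stands in for recursion on height. *)
Fixpoint transfer_rec A B n u :=
  if u == br_root A then br_root B else
  if n is m.+1 then
    nth (br_root B) (br_children B (transfer_rec A B m (br_parent A u)))
      (index u (br_children A (br_parent A u)))
  else br_root B.

Definition transfer A B u := transfer_rec A B (br_height A u) u.

Lemma transfer_root A B : transfer A B (br_root A) = br_root B.
Proof. by rewrite /transfer; case: br_height => /= [|n]; rewrite eqxx. Qed.

Lemma transfer_rec_fuel A B m n u : br_height A u <= m -> br_height A u <= n ->
  transfer_rec A B m u = transfer_rec A B n u.
Proof.
elim: m n u => [|m IH] [|n] u //=; have [//|/br_heightP uP] := eqVneq => um un.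
- by move: (leq_trans uP um).
- by move: (leq_trans uP un).
by rewrite (IH n) // -ltnS; apply: leq_trans uP _.
Qed.

Lemma transfer_step A B u : u != br_root A ->
  transfer A B u =
  nth (br_root B) (br_children B (transfer A B (br_parent A u)))
    (index u (br_children A (br_parent A u))).
Proof.
move=> u0; rewrite /transfer; have uP := br_heightP u0.
case: (br_height A u) uP => // n uP /=.
by rewrite (negPf u0) (@transfer_rec_fuel A B n (br_height A (br_parent A u))).
Qed.

Section Compatible.
Variables A B : branching V Y.
Hypothesis AB : compatible A B.

Lemma index_children x : x != br_root A ->
  index x (br_children A (br_parent A x)) <
  size (br_children A (br_parent A x)).
Proof. by move=> x0; rewrite index_mem br_mem x0 eqxx. Qed.

(** Inductively, a parent and its image have equal lists of child labels, so the index of [x] is in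
    range there and finds the same label. *)
Lemma transfer_label x : br_label B (transfer A B x) = br_label A x.
Proof.
elim/(@branching_ind A): x => [|x x0 IH]; first by rewrite transfer_root AB.1.
have si := index_children x0; have E := AB.2 _ _ (esym IH).
rewrite transfer_step //.
have sE := congr1 size E; rewrite !size_map in sE.
rewrite -(nth_map _ (br_label B (br_root B))) -?sE // -E.
by rewrite (nth_map x) // nth_index // br_mem x0 eqxx.
Qed.

Lemma transfer_child x : x != br_root A ->
  transfer A B x \in br_children B (transfer A B (br_parent A x)).
Proof.
move=> x0; rewrite transfer_step // mem_nth //.
have := congr1 size (AB.2 _ _ (esym (transfer_label (br_parent A x)))).
by rewrite !size_map => <-; apply: index_children.
Qed.

Lemma transfer_neq_root x : x != br_root A -> transfer A B x != br_root B.
Proof. by move/transfer_child; rewrite br_mem => /andP[]. Qed.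

Lemma transfer_parent x : x != br_root A ->
  br_parent B (transfer A B x) = transfer A B (br_parent A x).
Proof. by move/transfer_child; rewrite br_mem => /andP[_ /eqP]. Qed.

(** Siblings do not repeat, so [x] and its image have the same index and transferring back returns
    [x]. *)
Lemma transferK : cancel (transfer A B) (transfer B A).
Proof.
elim/(@branching_ind A) => [|x x0 IH]; first by rewrite !transfer_root.
rewrite transfer_step ?transfer_neq_root // transfer_parent // IH.
rewrite [transfer A B x]transfer_step // index_uniq ?br_uniq //; last first.
  have := congr1 size (AB.2 _ _ (esym (transfer_label (br_parent A x)))).
  by rewrite !size_map => <-; apply: index_children.
by rewrite nth_index // br_mem x0 eqxx.
Qed.

End Compatible.
End Transfer.

(** * Rerooting the unfolding tree *)

HB.instance Definition _ (G : digraph) (R : vertex G) :=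
  gen_eqMixin (unf_vertex R).

Lemma In_rcons (A : Type) (a b : A) s :
  List.In a (rcons s b) <-> a = b \/ List.In a s.
Proof.
by elim: s => [|c s IH] /=; [split=> -[->|] | rewrite IH]; intuition.
Qed.

Section PathCat.
Variable G : digraph.

Lemma terminus_cat (u : vertex G) p q :
  terminus u (p ++ q) = terminus (terminus u p) q.
Proof. by rewrite /terminus map_cat last_cat. Qed.

Lemma is_path_cat (u : vertex G) p q :
  is_path u (p ++ q) <-> is_path u p /\ is_path (terminus u p) q.
Proof.
elim: p u => [|e p IH] u /=; first by split=> [|[]].
have := IH (tgt e); rewrite {2}/terminus /= -/(terminus (tgt e) p) => {}IH.
by split=> [[eu /IH[]]|[[eu ep] pq]]; do ?split => //; apply/IH.
Qed.

End PathCat.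

Section Reroot.
Variables (G : finDigraph) (R : fvertex G).

Local Notation pathR := (@is_path G R).
Local Notation endR := (@terminus G R).
Local Notation V := (@unf_vertex G R).
Local Notation D := (@unf_edge G R).
Local Notation T := (@unfolding_tree G R).
Implicit Types (p q : seq (fedge G)) (v w x : V) (d : D).

Lemma sval_inj : injective (@sval _ _ : V -> seq (fedge G)).
Proof. by case=> [p pP] [q qP] /= pq; apply: eq_exist. Qed.

Lemma prefix_is_path p q : prefix p q -> pathR q -> pathR p.
Proof. by case/prefixP=> s -> /is_path_cat[]. Qed.

Lemma prefix_rconsE p q (e : fedge G) :
  prefix p (rcons q e) = (p == rcons q e) || prefix p q.
Proof.
apply/idP/orP => [|[/eqP->|]]; last 2 first.
- exact: prefix_refl.
- by move/prefix_trans; apply; apply: prefix_rcons.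
case/prefixP=> s; case/lastP: s => [|s f].
  by rewrite cats0 => ->; left.
by rewrite -rcons_cat => /rcons_inj[-> _]; right; apply: prefix_prefix.
Qed.

Lemma path_edge p (e : fedge G) : pathR (rcons p e) ->
  exists d, sval (unf_path d) = p /\ unf_last d = e.
Proof.
by case/is_path_rcons=> pP ep; exists (@UnfEdge G R (exist _ p pP) e ep).
Qed.

Lemma unf_edge_eq d d' :
  sval (unf_path d) = sval (unf_path d') -> unf_last d = unf_last d' -> d = d'.
Proof.
move=> pp; apply: unf_edge_inj.
by case: (unf_path d) (unf_path d') pp => p pP [q qP] /= pq; apply: sval_inj.
Qed.

(** The tree path to [v] runs through the prefixes of [v], so rerooting reverses exactly the edges
    ending at one of them. *)
Lemma on_root_path_prefix v d :
  `[< @on_root_path T v d >] = prefix (sval (unf_tgt d)) (sval v).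
Proof.
apply/asboolP/idP => [[s [[sP sT] ds]]|].
  elim/last_ind: s v sP sT ds => // s d' IH v.
  move=> sdP; have [sP sT] := (is_path_rcons _ _ _).1 sdP.
  rewrite terminus_rcons => <-.
  case/In_rcons => [->|ds]; first exact: prefix_refl.
  by rewrite /= prefix_rconsE (IH _ _ (esym sT)) // orbT.
case: v => q qP /=; elim/last_ind: q qP => [|q e IH] qP.
  by rewrite prefixs0 -size_eq0 size_rcons.
have [d' [d'q d'e]] := path_edge qP.
have qR : pathR q by case/is_path_rcons: qP.
have d'qE : unf_path d' = exist _ q qR.
  by case: (unf_path d') d'q => r rP /= ?; apply: sval_inj.
have Ev s : path_between (tree_root T) (exist _ q qR : vertex T) s ->
    path_between (tree_root T) (exist _ (rcons q e) qP : vertex T) (rcons s d').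
  case=> sP sT; split.
    by apply: (is_path_rcons _ _ _).2; split; rewrite // sT.
  by rewrite terminus_rcons; apply: sval_inj; rewrite /= d'q d'e.
rewrite prefix_rconsE => /orP[/eqP dE|/(IH qR)[s [sP ds]]].
  have [s [sP _]] := @unf_graph_tree G R (exist _ q qR).
  exists (rcons s d'); split; first exact: Ev.
  apply/In_rcons; left; have [dp de] := rcons_inj dE.
  by apply: unf_edge_eq; rewrite ?d'q ?d'e.
by exists (rcons s d'); split; [apply: Ev | apply/In_rcons; right].
Qed.

Local Notation rorg v d := (@org (@reroot T v) d : V).
Local Notation rtgt v d := (@tgt (@reroot T v) d : V).

Lemma rorgE v d : rorg v d =
  if prefix (sval (unf_tgt d)) (sval v) then unf_tgt d else unf_path d.
Proof. by rewrite /= on_root_path_prefix. Qed.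

Lemma rtgtE v d : rtgt v d =
  if prefix (sval (unf_tgt d)) (sval v) then unf_path d else unf_tgt d.
Proof. by rewrite /= on_root_path_prefix. Qed.

Lemma reroot_tgt_neq v d : rtgt v d != v.
Proof.
rewrite rtgtE; case: ifP => dv; apply/eqP => E.
  by have := size_prefix dv; rewrite -E /= size_rcons ltnn.
by move: dv; rewrite -E prefix_refl.
Qed.

Lemma reroot_tgt_surj v x : x != v -> exists d, rtgt v d = x.
Proof.
move=> xv; have [xpv|xpv] := boolP (prefix (sval x) (sval v)).
  case/prefixP: (xpv) => -[|e s] vE.
    by case/eqP: xv; apply: sval_inj; rewrite cats0 in vE.
  have ve : prefix (rcons (sval x) e) (sval v).
    by rewrite vE -cat_rcons prefix_prefix.
  have [d [dx de]] := path_edge (prefix_is_path ve (proj2_sig v)).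
  exists d; rewrite rtgtE /= dx de ve.
  exact: sval_inj.
case: x xv xpv => x; case/lastP: x => [|p e] xP xv xpv.
  by rewrite /= prefix0s in xpv.
have [d [dx de]] := path_edge xP; exists d.
rewrite rtgtE /= dx de (negPf xpv).
by apply: sval_inj; rewrite /= dx de.
Qed.

(** Parent of [p] after rerooting at [q]: a proper prefix of [q] moves one edge along [q], a
    non-prefix drops its last edge; [p = q] gives the junk value [q]. *)
Definition parent_path (q p : seq (fedge G)) :=
  if prefix p q then take (size p).+1 q else take (size p).-1 p.

Lemma parent_is_path q p : pathR q -> pathR p -> pathR (parent_path q p).
Proof.
by rewrite /parent_path => qP pP; case: ifP => _;
  apply: (prefix_is_path (prefix_take _ _)).
Qed.

Definition rparent v x : V :=
  exist _ _ (parent_is_path (proj2_sig v) (proj2_sig x)).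

Lemma reroot_org v d : rorg v d = rparent v (rtgt v d).
Proof.
rewrite rorgE rtgtE; case: ifP => dv; apply: sval_inj => /=.
  rewrite /parent_path ifT; last exact: prefix_trans (prefix_rcons _ _) dv.
  by move: dv; rewrite prefixE size_rcons => /eqP.
by rewrite /parent_path dv size_rcons -cats1 take_size_cat.
Qed.

(** The target determines the origin through [rparent], so both edges join the same two paths;
    comparing lengths excludes opposite directions in the original tree. *)
Lemma reroot_tgt_inj v : injective (fun d => rtgt v d).
Proof.
move=> d d' dd; have := reroot_org v d; rewrite dd -reroot_org.
move: dd; rewrite !rtgtE !rorgE.
have N (c c' : D) :
    unf_path c = unf_tgt c' -> unf_tgt c = unf_path c' -> c = c'.
  move=> /(congr1 (size \o sval)) /= + /(congr1 (size \o sval)) /=.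
  by rewrite !size_rcons => -> /esym/eqP; rewrite ltn_eqF.
have S (c c' : D) :
    unf_path c = unf_path c' -> unf_tgt c = unf_tgt c' -> c = c'.
  move=> /(congr1 sval) cc /(congr1 sval) /= /rcons_inj[_ ?].
  exact: unf_edge_eq.
by do 2!case: ifP => _; auto.
Qed.

(** The distance to [v] on prefixes of [v], and an upper bound of it elsewhere. *)
Definition rheight v x :=
  if prefix (sval x) (sval v) then size (sval v) - size (sval x)
  else size (sval v) + size (sval x).

Lemma rheight_parent v x : x != v -> rheight v (rparent v x) < rheight v x.
Proof.
rewrite /rheight /= /parent_path => xv.
case: (boolP (prefix (sval x) (sval v))) => xpv.
  rewrite prefix_take; case/prefixP: xpv => -[|e s] vE.
    by case/eqP: xv; apply: sval_inj; rewrite cats0 in vE.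
  rewrite vE -cat_rcons take_size_cat ?size_rcons // size_cat size_rcons.
  by rewrite addKn addSn -addnS addKn.
case: (x) xpv => p; case/lastP: p => [|p e] _ /=; first by rewrite prefix0s.
rewrite size_rcons -cats1 take_size_cat //= addnS ltnS => _.
by case: ifP => _; rewrite ?leq_addr // leq_subLR addnCA leq_addr.
Qed.

(** * Neighbours in the unfolding tree *)

Definition parents p := if p is e :: q then [:: belast e q] else [::].

Definition children p :=
  [seq rcons p e | e <- enum (fedge G) & forg e == endR p].

Definition nbr p := parents p ++ children p.

Lemma parents_rcons p e : parents (rcons p e) = [:: p].
Proof. by case: p => //= f p; rewrite belast_rcons. Qed.

Lemma mem_parents p q : reflect (exists e, p = rcons q e) (q \in parents p).
Proof.
apply: (iffP idP) => [|[e ->]]; last by rewrite parents_rcons inE.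
by case/lastP: p => // p e; rewrite parents_rcons inE => /eqP->; exists e.
Qed.

Lemma mem_children p q :
  reflect (exists2 e, forg e = endR p & q = rcons p e) (q \in children p).
Proof.
apply: (iffP mapP) => -[e]; first by rewrite mem_filter => /andP[/eqP]; exists e.
by move=> ep ->; exists e; rewrite // mem_filter ep eqxx mem_enum.
Qed.

Lemma nbr_is_path p q : pathR p -> q \in nbr p -> pathR q.
Proof.
move=> pP; rewrite mem_cat => /orP[/mem_parents[e pE]|/mem_children[e ep ->]].
  by move: pP; rewrite pE => /is_path_rcons[].
exact/is_path_rcons.
Qed.

Lemma nbr_uniq p : uniq (nbr p).
Proof.
rewrite cat_uniq; apply/and3P; split; first by case: p.
  apply/hasPn => q /mem_children[e _ ->]; apply/negP => /mem_parents[f].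
  by move/(congr1 size)/eqP; rewrite !size_rcons ltn_eqF // ltnW.
by rewrite map_inj_uniq => [|e f /rcons_inj[]//]; apply/filter_uniq/enum_uniq.
Qed.

Definition insub_path p : option V :=
  if pselect (pathR p) is left pP then Some (exist _ p pP) else None.

Definition unf_nbr x : seq V := pmap insub_path (nbr (sval x)).

Lemma val_unf_nbr x : map sval (unf_nbr x) = nbr (sval x).
Proof.
rewrite /unf_nbr; have: forall q, q \in nbr (sval x) -> pathR q.
  by move=> q; apply: nbr_is_path; case: (x).
elim: nbr => // q s IH qsP /=; rewrite /insub_path; case: pselect => /= [qP|[]].
  by rewrite IH // => r rs; apply: qsP; rewrite inE rs orbT.
by apply: qsP; rewrite inE eqxx.
Qed.

Lemma mem_unf_nbr x y : (y \in unf_nbr x) = (sval y \in nbr (sval x)).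
Proof. by rewrite -val_unf_nbr mem_map //; apply: sval_inj. Qed.

Lemma unf_nbr_uniq x : uniq (unf_nbr x).
Proof. by apply: (@map_uniq V _ sval); rewrite val_unf_nbr nbr_uniq. Qed.

(** Rerooting only flips edges, so adjacency is the same for every [v]. *)
Lemma unf_nbrP v x y : reflect
  (exists d, (rorg v d, rtgt v d) = (x, y) \/ (rorg v d, rtgt v d) = (y, x))
  (y \in unf_nbr x).
Proof.
suff: reflect (exists d, (unf_path d, unf_tgt d) = (x, y) \/
    (unf_path d, unf_tgt d) = (y, x)) (y \in unf_nbr x).
  move=> H; apply: (iffP H) => -[d dxy]; exists d; move: dxy;
  by rewrite rorgE rtgtE; case: ifP => _ [] [-> ->]; auto.
rewrite mem_unf_nbr mem_cat; apply: (iffP orP).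
  case=> [/mem_parents[e xE]|/mem_children[e ex yE]].
    have xP := proj2_sig x; rewrite xE in xP; have [d [dp de]] := path_edge xP.
    by exists d; right; congr pair; apply: sval_inj => //=; rewrite dp de.
  have yP := proj2_sig y; rewrite yE in yP; have [d [dp de]] := path_edge yP.
  by exists d; left; congr pair; apply: sval_inj => //=; rewrite dp de.
case=> d [] [<- <-]; [right|left]; last by apply/mem_parents; exists (unf_last d).
by apply/mem_children; exists (unf_last d) => //; apply: (unf_edgeP d).
Qed.

End Reroot.

(** * From actual labellings to cocompactness *)

Section Equitable.
Variables (G : finDigraph) (R : fvertex G) (X : finType).

Local Notation V := (@unf_vertex G R).
Local Notation D := (@unf_edge G R).
Local Notation T := (@unfolding_tree G R).
Local Notation rorg v d := (@org (@reroot T v) d : V).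
Local Notation rtgt v d := (@tgt (@reroot T v) d : V).

Variable L : V -> X.
Hypothesis L_equitable : forall x y, L x = L y ->
  perm_eq (map L (unf_nbr x)) (map L (unf_nbr y)).
Implicit Types (v w x y : V).

Lemma rparent_nbr v x : x != v -> rparent v x \in unf_nbr x.
Proof.
move=> /reroot_tgt_surj[d <-]; apply/(unf_nbrP v).
by exists d; right; rewrite -reroot_org.
Qed.

Definition rank_le : rel X := relpre enum_rank leq.

(* Sorting by label makes the list of labels of the children of a vertex
   depend only on the label of that vertex and of its parent. *)
Definition rchildren v x := sort (relpre L rank_le)
  (if x == v then unf_nbr x else rem (rparent v x) (unf_nbr x)).

Lemma rchildren_uniq v x : uniq (rchildren v x).
Proof.
by rewrite sort_uniq; case: ifP => _; rewrite ?rem_uniq ?unf_nbr_uniq.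
Qed.

Lemma mem_rchildren v y x :
  (y \in rchildren v x) = (y != v) && (rparent v y == x).
Proof.
have -> : (y \in rchildren v x) =
    (y \in unf_nbr x) && ((x == v) || (y != rparent v x)).
  rewrite mem_sort; case: eqVneq => _ /=; first by rewrite andbT.
  by rewrite mem_rem_uniq ?unf_nbr_uniq // !inE andbC.
apply/andP/andP => [[/(unf_nbrP v)[d []]]|[yv /eqP xE]].
- case=> <- <- _; rewrite reroot_tgt_neq; split=> //.
  by rewrite -reroot_org.
- case=> <- <-; rewrite (negPf (reroot_tgt_neq _ _)) /=.
  by rewrite -reroot_org eqxx.
have xy := rparent_nbr yv; rewrite xE in xy; split.
  move: xy => /(unf_nbrP v)[d dyx]; apply/(unf_nbrP v).
  by exists d; case: dyx; auto.
(* Were [y] also the parent of [x], heights would decrease in both directions. *)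
have [//|xv /=] := eqVneq x v; apply/eqP => yE.
have := rheight_parent yv; have := rheight_parent xv.
by rewrite xE -yE => /ltnW; rewrite leqNgt => /negP.
Qed.

Definition rlabel v x :=
  (if x == v then None else Some (L (rparent v x)), L x).

Definition rbranching v : branching V (option X * X)%type :=
  Branching (rlabel v) (rchildren_uniq v) (mem_rchildren v)
    (@rheight_parent _ _ v).

(** Cancelling the common parent label from equal neighbour multisets leaves equal multisets of
    child labels; sorting makes them equal lists. *)
Lemma rbranching_compatible v w :
  L v = L w -> compatible (rbranching v) (rbranching w).
Proof.
move=> vw; split=> [|x y] /=; first by rewrite /rlabel !eqxx vw.
case=> xyp xy.
have E u z : map (rlabel u) (rchildren u z) =
    map (pair (Some (L z))) (map L (rchildren u z)).
  rewrite -map_comp; apply/eq_in_map => t; rewrite mem_rchildren /= /rlabel.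
  by case/andP => /negPf-> /eqP->.
rewrite !E xy -!sort_map; congr map; apply/perm_sortP.
- by move=> a b; apply: leq_total.
- by move=> a b c; apply: leq_trans.
- by move=> a b; rewrite -eqn_leq => /eqP/val_inj/enum_rank_inj.
have N u z : z != u -> perm_eq (map L (unf_nbr z))
    (L (rparent u z) :: map L (rem (rparent u z) (unf_nbr z))).
  by move=> zu; apply: (perm_map L (perm_to_rem (rparent_nbr zu))).
have := L_equitable xy; case: eqVneq xyp => [_|xv]; case: eqVneq => [_|yw] //.
case=> xyp; rewrite (permPl (N _ _ xv)) (permPr (N _ _ yw)) xyp.
by rewrite perm_cons.
Qed.

Lemma reroot_isomorphic v w :
  L v = L w -> isomorphic (@reroot T v) (@reroot T w).
Proof.
move=> vw; have C := rbranching_compatible vw; have C' := compatible_sym C.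
pose f := transfer (rbranching v) (rbranching w).
pose f' := transfer (rbranching w) (rbranching v).
have fK : cancel f f' := transferK C.
have fK' : cancel f' f := transferK C'.
have fv x : x != v -> f x != w := @transfer_neq_root _ _ _ _ C x.
have fw x : x != w -> f' x != v := @transfer_neq_root _ _ _ _ C' x.
(* Edges of a rerooted tree correspond to non-root vertices through their targets, so vertex maps
   induce the edge maps. *)
have /choice[g gE] (d : D) : exists d', rtgt w d' = f (rtgt v d).
  by apply/reroot_tgt_surj/fv/reroot_tgt_neq.
have /choice[g' gE'] (d : D) : exists d', rtgt v d' = f' (rtgt w d).
  by apply/reroot_tgt_surj/fw/reroot_tgt_neq.
exists f, g; split.
- by exists f'.
- exists g' => d; first by apply: (@reroot_tgt_inj _ _ v); rewrite gE' gE fK.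
  by apply: (@reroot_tgt_inj _ _ w); rewrite gE gE' fK'.
- move=> d; rewrite !reroot_org gE.
  exact: (@transfer_parent _ _ _ _ C) (reroot_tgt_neq v d).
- exact: gE.
Qed.

End Equitable.

(** * Pulling an actual labelling back to the tree *)

Section LabellingCocompact.
Local Open Scope mset_scope.
Variables (G : finDigraph) (R : fvertex G).

Lemma mset_map_seq_mset (A B : choiceType) (f : A -> B) s :
  mset_map f (seq_mset s) = seq_mset (map f s).
Proof. exact/eq_seq_msetP/perm_map/perm_eq_seq_mset. Qed.

Lemma seq_mset_cons (A : choiceType) (a : A) s :
  seq_mset (a :: s) = a +` seq_mset s.
Proof. by apply/msetP => b; rewrite mset1DE !mset_seqE /= eq_sym. Qed.

Lemma mset_map_out_mset (A : choiceType) (l : fvertex G -> A) p :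
  mset_map l (out_mset (@terminus G R p)) =
  seq_mset (map (l \o @terminus G R) (children R p)).
Proof.
rewrite mset_map_seq_mset -!map_comp; congr seq_mset; apply: eq_map => e /=.
by rewrite terminus_rcons.
Qed.

(** By [al_in], the label removed in [al_out] is that of the parent path, so including the parent
    restores it; the empty path uses [al_out_root]. *)
Lemma actual_labelling_nbr (X : finType) (l : fvertex G -> X)
    (lp : {v : fvertex G | v != R} -> X) (M : X -> {mset X}) p :
  is_actual_labelling l lp M -> @is_path G R p ->
  seq_mset (map (l \o @terminus G R) (nbr R p)) = M (l (@terminus G R p)).
Proof.
case=> Rin lpM out lin outR; case/lastP: p => [_|p e pP].
  by rewrite -outR -[X in out_mset X]/(@terminus G R [::]) mset_map_out_mset.
have eR : ftgt e != R by apply/eqP/Rin.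
have [_ ep] := (is_path_rcons _ _ _).1 pP.
rewrite /nbr parents_rcons map_cat /= seq_mset_cons.
rewrite -mset_map_out_mset terminus_rcons.
rewrite (out (exist _ (ftgt e) eR)) -ep.
have /= -> := lin (exist _ (ftgt e) eR) e erefl.
exact: msetB1K (lpM _).
Qed.

Lemma labelling_cocompact :
  admits_actual_labelling R -> cocompact (@unfolding_tree G R).
Proof.
case=> X [l [lp [M lM]]].
exists X, (l \o @terminus G R \o sval) => v w.
apply: reroot_isomorphic => x y /= xy.
rewrite !(map_comp _ sval) !val_unf_nbr; apply/eq_seq_msetP.
by rewrite !(actual_labelling_nbr lM) ?xy //; [case: y {xy}|case: x {xy}].
Qed.

End LabellingCocompact.

(** * From cocompactness to actual labellings *)

Local Open Scope mset_scope.

Lemma mset1DI (K : choiceType) (A : {mset K}) a b : a +` A = b +` A -> a = b.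
Proof.
by move/(congr1 (fun B : {mset K} => B a)) => /eqP;
  rewrite !mset1DE eqn_add2r eqxx; case: (a =P b).
Qed.

Section ColourRefinement.
Variables (G : finDigraph) (R : fvertex G).

Local Notation pathR := (@is_path G R).
Local Notation endR := (@terminus G R).
Local Notation V := (@unf_vertex G R).
Local Notation D := (@unf_edge G R).
Local Notation T := (@unfolding_tree G R).
Local Notation rorg v d := (@org (@reroot T v) d : V).
Local Notation rtgt v d := (@tgt (@reroot T v) d : V).
Implicit Types (v w x : V) (p q : seq (fedge G)).

Fixpoint colour_type n : choiceType :=
  if n is m.+1 then {mset colour_type m} else unit.

Fixpoint colour n p : colour_type n :=
  if n is m.+1 then seq_mset (map (colour m) (nbr R p)) else tt.

Lemma colourS n p : colour n.+1 p = seq_mset (map (colour n) (nbr R p)).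
Proof. by []. Qed.

(** Truncation of the nested multisets at their innermost level; it shows that later rounds refine
    earlier ones. *)
Fixpoint coarsen n : colour_type n.+1 -> colour_type n :=
  if n is m.+1 then mset_map (@coarsen m) else fun=> tt.

Lemma coarsenE n p : coarsen (colour n.+1 p) = colour n p.
Proof.
elim: n p => // n IH p.
rewrite [coarsen _]mset_map_seq_mset -map_comp; congr seq_mset.
exact: eq_map.
Qed.

Lemma colour_leq m n p q :
  m <= n -> colour n p = colour n q -> colour m p = colour m q.
Proof.
elim: n => [|n IH]; first by rewrite leqn0 => /eqP->.
rewrite leq_eqVlt => /predU1P[->//|mn /(congr1 (@coarsen _))].
by rewrite !coarsenE; apply: IH.
Qed.

(** Within distance [n] of [p ++ q] every vertex still extends [p], and such extensions see only the
    terminus of [p]. *)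
Lemma colour_local n p p' q : endR p = endR p' -> n <= size q ->
  colour n (p ++ q) = colour n (p' ++ q).
Proof.
move=> pp'; elim: n q => // n IH q; case/lastP: q => // q e.
rewrite size_rcons ltnS => nq; rewrite !colourS; congr seq_mset.
rewrite /nbr !map_cat -!rcons_cat !parents_rcons /= IH //; congr cons.
rewrite /children -!map_comp !rcons_cat !terminus_cat pp'; apply: eq_map => f /=.
by rewrite !rcons_cat IH // !size_rcons leqW // leqW.
Qed.

Lemma isomorphic_nbr v w : isomorphic (@reroot T v) (@reroot T w) ->
  exists f : V -> V,
    f v = w /\ forall x, perm_eq (map f (unf_nbr x)) (unf_nbr (f x)).
Proof.
case=> f [g [[f' fK fK'] [g' gK gK'] fo ft]].
have fo' d : rorg w (g d) = f (rorg v d) by apply: fo.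
have ft' d : rtgt w (g d) = f (rtgt v d) by apply: ft.
exists f; split.
  (* Otherwise [f v] is the target of an edge, whose preimage would enter the root [v]. *)
  have [//|/reroot_tgt_surj[d]] := eqVneq (f v : V) w.
  rewrite -(gK' d) ft' => /(can_inj fK)/eqP.
  by rewrite (negPf (reroot_tgt_neq _ _)).
move=> x; apply: uniq_perm; rewrite ?unf_nbr_uniq //.
  by rewrite map_inj_uniq ?unf_nbr_uniq //; apply: can_inj fK.
move=> y; rewrite -(fK' y) mem_map; last exact: can_inj fK.
apply/(unf_nbrP v)/(unf_nbrP w) => -[d dE].
  by exists (g d); rewrite fo' ft'; case: dE => -[<- <-]; [left|right].
exists (g' d); rewrite -(gK' d) fo' ft' in dE.
by case: dE => -[/(can_inj fK)<- /(can_inj fK)<-]; [left|right].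
Qed.

Lemma isomorphic_colour n v w : isomorphic (@reroot T v) (@reroot T w) ->
  colour n (sval v) = colour n (sval w).
Proof.
case/isomorphic_nbr=> f [<- fnbr]; elim: n v {w} => // n IH v.
rewrite !colourS; apply/eq_seq_msetP; rewrite -!val_unf_nbr.
have := perm_map (colour n \o sval : V -> _) (fnbr v).
rewrite -map_comp (eq_map (g := colour n \o sval)) => [|x]; last exact/esym/IH.
by rewrite !(map_comp _ sval).
Qed.

Lemma colour_stable : cocompact T ->
  exists (F : finType) (l : V -> F) N,
    (forall v w, l v = l w -> forall n, colour n (sval v) = colour n (sval w)) /\
    (forall v w, colour N (sval v) = colour N (sval w) ->
       forall n, colour n (sval v) = colour n (sval w)).
Proof.
case=> F [l lP].
have lc v w : l v = l w -> forall n, colour n (sval v) = colour n (sval w).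
  by move=> vw n; apply/isomorphic_colour/lP.
(* For each pair of classes, [k] is a round separating their colours, or 0 if there is none; the
   maximum over the finitely many pairs serves as [N]. *)
have /choice[b bP] (fg : F * F) : exists k, forall v w,
    l v = fg.1 -> l w = fg.2 -> colour k (sval v) = colour k (sval w) ->
    forall n, colour n (sval v) = colour n (sval w).
  have [[n [v [w [vf wg vw]]]]|H] := pselect (exists n v w,
      [/\ l v = fg.1, l w = fg.2 & colour n (sval v) <> colour n (sval w)]).
    exists n => v' w' vf' wg' vw'; case: vw.
    by rewrite (lc v v') ?vf // (lc w w') ?wg.
  exists 0 => v w vf wg _ n; apply: contrapT => vw; apply: H.
  by exists n, v, w.
exists F, l, (\max_fg b fg); split=> // v w vw.
apply: (bP (l v, l w)) => //; apply: colour_leq vw.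
exact: (leq_bigmax (l v, l w)).
Qed.

Lemma cocompact_equitable : cocompact T ->
  exists (X : finType) (rho : seq (fedge G) -> X) (N : nat),
    (forall p p', pathR p -> pathR p' -> rho p = rho p' ->
       seq_mset (map rho (nbr R p)) = seq_mset (map rho (nbr R p'))) /\
    (forall p p' q, endR p = endR p' -> N <= size q ->
       rho (p ++ q) = rho (p' ++ q)).
Proof.
case/colour_stable=> F [l [N [lc stable]]].
(* Colours need not lie in a finite type, so each is encoded by the set of classes realising it; for
   the colour of a path this set is nonempty and determines the colour. *)
pose h c : {set F} :=
  [set f | `[< exists2 v, l v = f & colour N (sval v) = c >]].
exists {set F}, (fun p => h (colour N p)), N.
split=> [p p' pP pP' hh|p p' q pp' Nq].
  have pN : colour N p = colour N p'.
    have: l (exist _ p pP) \in h (colour N p).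
      by rewrite inE; apply/asboolP; exists (exist _ p pP).
    by rewrite hh inE => /asboolP[v /lc/(_ N) <- <-].
  have := congr1 (mset_map h) (stable (exist _ p pP) (exist _ p' pP') pN N.+1).
  by rewrite !colourS !mset_map_seq_mset -!map_comp.
by rewrite (colour_local pp' Nq).
Qed.

End ColourRefinement.

(** * Descent of stable colours to the base graph *)

Section CocompactLabelling.
Variables (G : finDigraph) (R : fvertex G).
Hypothesis G_rooted : rooted (R : vertex G).
Hypothesis G_sinkless : sinkless G.

Local Notation pathR := (@is_path G R).
Local Notation endR := (@terminus G R).

Variables (X : finType) (rho : seq (fedge G) -> X) (N : nat).
Hypothesis rho_nbr : forall p p', pathR p -> pathR p' -> rho p = rho p' ->
  seq_mset (map rho (nbr R p)) = seq_mset (map rho (nbr R p')).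
Hypothesis rho_local : forall p p' q, endR p = endR p' -> N <= size q ->
  rho (p ++ q) = rho (p' ++ q).

Lemma nbr_rcons_mset p e :
  seq_mset (map rho (nbr R (rcons p e))) =
  rho p +` seq_mset (map rho (children R (rcons p e))).
Proof. by rewrite /nbr parents_rcons seq_mset_cons. Qed.

(* Deep extensions [p ++ q] and [p' ++ q] have the same colour by locality; the
   colour of the parent of a vertex is then recovered by removing the colours of
   its children from those of its neighbours. *)
Lemma rho_terminus p p' : pathR p -> pathR p' -> endR p = endR p' ->
  rho p = rho p'.
Proof.
move=> pP pP' pp'.
(* [k] bounds how many edges [q] lacks to reach length [N]; the goal is the case of empty [q]. *)
suff H k q : is_path (endR p) q -> N <= size q + k ->
    rho (p ++ q) = rho (p' ++ q).
  by have := H N [::] I (leqnn _); rewrite !cats0.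
elim: k q => [|k IH] q qP; first by rewrite addn0; apply: rho_local.
rewrite addnS => Nq.
have [e e_org] : exists e, forg e = endR (p ++ q).
  apply: contrapT => ne; apply: (G_sinkless (v := endR (p ++ q))) => e ev.
  by apply: ne; exists e.
have qeP : is_path (endR p) (rcons q e).
  by apply/is_path_rcons; rewrite -terminus_cat.
have Nqe : N <= size (rcons q e) + k by rewrite size_rcons addSn.
have chE : map rho (children R (p ++ rcons q e)) =
    map rho (children R (p' ++ rcons q e)).
  rewrite /children -!map_comp !terminus_cat -pp'; apply/eq_in_map => f /=.
  rewrite mem_filter => /andP[/eqP fE _]; rewrite !rcons_cat IH //.
    exact/is_path_rcons.
  by rewrite size_rcons addSn (leq_trans Nqe).
have qeRP r : pathR r -> endR p = endR r -> pathR (r ++ rcons q e).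
  by move=> rP pr; apply/is_path_cat; rewrite -pr.
have := rho_nbr (qeRP _ pP erefl) (qeRP _ pP' pp') (IH _ qeP Nqe).
by rewrite -!rcons_cat !nbr_rcons_mset !rcons_cat chE => /mset1DI.
Qed.

Lemma equitable_labelling : admits_actual_labelling R.
Proof.
have /choice[pth pthP] (x : fvertex G) : exists p, pathR p /\ endR p = x.
  exact: G_rooted.
pose lab x := rho (pth x).
have rhoE p : pathR p -> rho p = lab (endR p).
  by move=> pP; have [qP qE] := pthP (endR p); apply: rho_terminus.
have rcP p e : pathR p -> forg e = endR p -> pathR (rcons p e).
  by move=> pP ep; apply/is_path_rcons.
have chE p : pathR p ->
    seq_mset (map rho (children R p)) = mset_map lab (out_mset (endR p)).
  move=> pP; rewrite mset_map_out_mset; congr seq_mset; apply/eq_in_map.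
  by move=> q /mem_children[e ep ->] /=; apply/rhoE/rcP.
have nbrE p e : pathR (rcons p e) ->
    seq_mset (map rho (nbr R (rcons p e))) =
    rho p +` mset_map lab (out_mset (ftgt e)).
  by move=> peP; rewrite nbr_rcons_mset chE // terminus_rcons.
(* [M a] is read off any path of colour [a], with [mset0] for unrealised colours. *)
have /choice[M ME] (a : X) : exists m, forall p, pathR p -> rho p = a ->
    seq_mset (map rho (nbr R p)) = m.
  have [[p [pP <-]]|H] := pselect (exists p, pathR p /\ rho p = a).
    by exists (seq_mset (map rho (nbr R p))) => q qP /rho_nbr; apply.
  by exists mset0 => p pP pa; case: H; exists p.
have /choice[lp lpE] (v : {v : fvertex G | v != R}) : exists a,
    M (lab (val v)) = a +` mset_map lab (out_mset (val v)).
  have [pP pT] := pthP (val v); case/lastP: (pth _) pP pT => [_ vR|p e peP eT].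
    by have /eqP := valP v; rewrite -vR.
  (* [lp] is the colour of the parent of the chosen path, which is nonempty since its terminus is
     not [R]. *)
  exists (rho p); rewrite -(ME _ _ peP); last by rewrite rhoE // eT.
  by rewrite nbrE // -eT terminus_rcons.
exists X, lab, lp, M; split.
- move=> e eR; have [pP pT] := pthP (forg e).
  have peP := rcP _ e pP (esym pT).
  (* A nonempty path ending at [R] would be coloured like the empty one, yet its neighbour multiset
     has one more element, the parent. *)
  have: rho (rcons (pth (forg e)) e) = rho [::].
    by apply: rho_terminus => //; rewrite terminus_rcons.
  move/(rho_nbr peP (I : pathR [::])); rewrite nbrE // eR [in RHS]chE //.
  set a := rho _ => /(congr1 (fun A : {mset X} => A a))/eqP.
  by rewrite mset1DE eqxx gtn_eqF.
- by move=> v; rewrite lpE mset1D1.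
- by move=> v; rewrite lpE msetD1K.
- move=> v e ev; have [pP pT] := pthP (forg e).
  have peP := rcP _ e pP (esym pT).
  (* Any edge into [v] ends some path to [v]; cancelling the children in [M] leaves the parent
     colour, whichever edge is chosen. *)
  have := lpE v; rewrite -ev -(ME _ _ peP) ?nbrE ?rhoE // ?terminus_rcons //.
  by rewrite pT => /mset1DI.
- by rewrite -(chE [::]) // -(ME _ [::]) // rhoE.
Qed.

End CocompactLabelling.

Theorem theorem2 (G : finDigraph) (R : fvertex G) :
  rooted (R : vertex G) -> sinkless G ->
  (cocompact (unfolding_tree (R : vertex G)) <-> admits_actual_labelling R).
Proof.
move=> G_rooted G_sinkless; split; last exact: labelling_cocompact.
case/cocompact_equitable=> X [rho [N [rho_nbr rho_local]]].
exact: equitable_labelling rho_nbr rho_local.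
Qed.
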